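(* Let $(x_n)_{n=1}^{\infty}$ be a moment sequence for which there exist $c, \alpha > 0$ such that $$\lim_{n \rightarrow \infty} x_n \cdot n^{\alpha} = c.$$ For $x \in \mathbb{R}$ let $(a_n)_{n=0}^{\infty}$ (depending on $x$) be the sequence defined by $$a_0 = 0 \qquad \text{and, for } n \geq 1, \qquad a_n = \begin{cases} a_{n-1} + x_n & \text{if } a_{n-1} \leq x,\\ a_{n-1} - x_n & \text{if } a_{n-1} > x.\end{cases}$$ Then there exists a countable set $X \subset \mathbb{R}$ such that every $x \in \mathbb{R} \setminus X$ has the following property: if there exists an integer $m \geq 0$ such that $$\min\{a_m, a_{m+1}\} \leq x \leq \max\{a_m, a_{m+1}\}$$ and there exists $\ell \in \mathbb{N}$, $\ell \geq 1$, such that for all integers $j \geq 1$ with $j \geq m$ $$x_j \leq x_{j+1} + x_{j+2} + \dots + x_{j+\ell},$$ then for all $k \in \mathbb{N}$ there are infinitely many $n \in \mathbb{N}$ with $$|x - a_n| \leq \frac{1}{n^k}.$$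
   Context: A sequence of real numbers $(x_n)_{n=1}^{\infty}$ is called a moment sequence if there is a (nonnegative) Borel measure $\mu$ on $[0,1]$ such that $x_n = \int_0^1 t^n \, d\mu(t)$ (a finite number) for all $n \geq 1$. The measure $\mu$ is not required to have finite total mass; for instance $d\mu = \log(1/t)\,dt/t$ gives $x_n = 1/n^2$ for $n\ge 1$. ''Countable'' means finite or countably infinite. *)

(* Defs.v *)
(* Library: MathComp-Analysis. *)
From HB Require Import structures.
From mathcomp Require Import all_boot all_order all_algebra.
From mathcomp Require Import all_classical all_reals all_analysis.

Set Implicit Arguments.
Unset Strict Implicit.
Unset Printing Implicit Defensive.

Import Order.TTheory GRing.Theory Num.Theory.
Import numFieldNormedType.Exports.

Local Open Scope classical_set_scope.
Local Open Scope ring_scope.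

(* Sequences (x_n)_{n >= 1} are functions on nat whose value at 0 is ignored.
   A Borel measure on [0, 1] is the restriction to [0, 1] of a Borel measure on
   R; its total mass may be infinite. Since x_n is real, the equation says in
   particular that the integral is finite. *)
Definition moment_sequence (R : realType) (x : nat -> R) : Prop :=
  exists mu : {measure set (measurableTypeR R) -> \bar R},
    forall n : nat, (1 <= n)%N ->
      (\int[mu]_(t in `[0%R, 1%R]) (t ^+ n)%:E)%E = (x n)%:E.

Fixpoint greedy_sums (R : realType) (x : nat -> R) (y : R) (n : nat) : R :=
  match n with
  | 0%N => 0
  | n'.+1 => let a := greedy_sums x y n' in
             if a <= y then a + x n'.+1 else a - x n'.+1
  end.

(* Main.v *)
Require Import Defs.
From HB Require Import structures.
From mathcomp Require Import all_boot all_order all_algebra.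
From mathcomp Require Import all_classical all_reals all_analysis.
From mathcomp Require Import measurable_realfun.
From mathcomp Require Import zify ring lra.

Set Implicit Arguments.
Unset Strict Implicit.
Unset Printing Implicit Defensive.

Import Order.TTheory GRing.Theory Num.Theory.
Import numFieldNormedType.Exports.

Local Open Scope classical_set_scope.
Local Open Scope ring_scope.

(** Write [e n] for the error [greedy_sums x y n - y]: each step moves it by
a term of [x] against its sign. A step from an error smaller than [x n] changes
the sign, so that this step and the next one together move the error by only
[x n - x n.+1], against its original sign. So, once the error is as small as these
differences, the errors at every second index form a greedy process again, for
the sequence of differences. Iterating, the errors at
indices [2 ^ k] apart form a greedy process for the differences
[dyadic_diff x k], in which the [2 ^ k] terms of a block carry Thue-Morse signs.
If [x n = \int t ^+ n], then
[dyadic_diff x k n = \int t ^+ n * \prod_(i < k) (1 - t ^+ (2 ^ i))] for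
[n >= 1], hence these differences are nonnegative and nonincreasing; since [x n] is of
order [n ^ (- alpha)], they are of order [n ^ (- alpha - k)]
([dyadic_diff_power_order]). Errors that small, infinitely often for every [k],
are what has to be produced.

Call level [k] reached at [m] ([trapped]) when the error at [m + 2 ^ k] is
bounded by the preceding step [dyadic_diff x k m.+1] of level [k]. For large [m],
- level [k], once reached, stays reached along the progression of step [2 ^ k]
  and the errors there form a greedy process ([block_step], [trapped_next]);
- if two consecutive errors of this progression have the same sign, level [k.+1]
  is reached ([trapped_next]);
- otherwise the signs alternate forever, and the error is the sum of an
  alternating series ([trapped_ascend]). Then [y] is a finite signed sum of terms
  of [x] plus or minus that series: such [y] form a countable set, the
  exceptional set of the theorem ([exceptional_value]).
Level [0] is reached at the crossing of [y], and then at arbitrarily large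
indices, as [x j <= x (j + 1) + ... + x (j + l)] forces a new crossing within [l]
steps ([trapped_recurrent]). *)

(** * Iterated differences of a moment sequence *)

Fixpoint dyadic_diff (R : realType) (x : nat -> R) (k n : nat) : R :=
  match k with
  | 0%N => x n
  | k'.+1 => dyadic_diff x k' n - dyadic_diff x k' (n + 2 ^ k')%N
  end.

(** The factor [1 - t ^+ (2 ^ k)] of the integrand is what the difference with
shift [2 ^ k] adds. Integrability has to be carried along, because the measure
may be infinite near [0]. *)
Lemma dyadic_diff_integral (R : realType)
    (mu : {measure set (measurableTypeR R) -> \bar R}) (x : nat -> R)
    (hmu : forall n : nat, (1 <= n)%N ->
      (\int[mu]_(t in `[0%R, 1%R]) (t ^+ n)%:E)%E = (x n)%:E)
    (k n : nat) (n_gt0 : (0 < n)%N) :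
  let F := fun t : measurableTypeR R =>
    (t ^+ n * \prod_(i < k) (1 - t ^+ (2 ^ i)))%:E in
  mu.-integrable `[0%R, 1%R] F /\
  (\int[mu]_(t in `[0%R, 1%R]) F t)%E = (dyadic_diff x k n)%:E.
Proof.
have mD : measurable (`[0%R, 1%R] : set (measurableTypeR R)).
  exact: measurable_itv.
elim: k n n_gt0 => [|k IHk] n n_gt0 /=.
  have -> : (fun t : measurableTypeR R =>
      (t ^+ n * \prod_(i < 0) (1 - t ^+ (2 ^ i)))%:E) = (fun t => (t ^+ n)%:E).
    by apply/funext => t; rewrite big_ord0 mulr1.
  split; last exact: hmu.
  apply/integrableP; split.
    apply/measurable_EFinP.
    by apply: measurable_funX; exact: measurable_id.
  rewrite (eq_integral (fun t : measurableTypeR R => (t ^+ n)%:E)) ?hmu ?ltry// => t.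
  rewrite inE/= in_itv/= => /andP[t0 t1].
  by rewrite ger0_norm// exprn_ge0.
have [i1 e1] := IHk _ n_gt0.
have [i2 e2] := IHk (n + 2 ^ k)%N (ltn_addr _ n_gt0).
have FE : (fun t : measurableTypeR R =>
    (t ^+ n * \prod_(i < k.+1) (1 - t ^+ (2 ^ i)))%:E) =
    ((fun t : measurableTypeR R =>
        (t ^+ n * \prod_(i < k) (1 - t ^+ (2 ^ i)))%:E) \-
     (fun t : measurableTypeR R =>
        (t ^+ (n + 2 ^ k) * \prod_(i < k) (1 - t ^+ (2 ^ i)))%:E))%E.
  apply/funext => t /=; rewrite -EFinB; congr (_%:E).
  by rewrite big_ord_recr /= exprD; ring.
rewrite FE; split; first exact: integrableB.
rewrite integralB//; by rewrite e1 e2.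
Qed.

(** The integrand of [dyadic_diff_integral] is nonnegative on [0, 1] and
decreases with [n]. *)
Lemma moment_dyadic_diff_monotone (R : realType) (x : nat -> R) :
  moment_sequence x -> forall k n, (0 < n)%N ->
  0 <= dyadic_diff x k n.+1 <= dyadic_diff x k n.
Proof.
move=> [mu hmu] k n n_gt0.
have [i1 e1] := dyadic_diff_integral hmu k n_gt0.
have [i2 e2] := dyadic_diff_integral hmu k (ltn0Sn n).
have P0 (t : R) : 0 <= t <= 1 -> 0 <= \prod_(i < k) (1 - t ^+ (2 ^ i)).
  move=> t01; apply: prodr_ge0 => i _.
  by rewrite subr_ge0; apply: exprn_ile1; case/andP: t01.
rewrite -2!lee_fin -e1 -e2; apply/andP; split.
  apply: integral_ge0 => t /=; rewrite in_itv /= => t01.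
  by rewrite lee_fin mulr_ge0 ?P0 ?exprn_ge0//; case/andP: t01.
apply: le_integral => // t; rewrite inE /= in_itv /= => t01.
rewrite lee_fin ler_wpM2r ?P0// exprS.
by case/andP: t01 => t0 t1; rewrite ler_piMl// exprn_ge0.
Qed.

(** * Orders of magnitude *)

Lemma nonincreasing_nat1 (R : realType) (f : nat -> R) :
  (forall n, (0 < n)%N -> f n.+1 <= f n) ->
  forall m n, (0 < m)%N -> (m <= n)%N -> f n <= f m.
Proof.
move=> f1 m n m0 /subnKC <-; elim: (n - m)%N => [|j IHj]; first by rewrite addn0.
by rewrite addnS (le_trans (f1 _ _))//; lia.
Qed.

Definition power_order (R : realType) (f : nat -> R) (b : R) : Prop :=
  exists c C : R, exists N : nat, 0 < c /\
    forall n : nat, (N <= n)%N -> c <= f n * n%:R `^ b <= C.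

Lemma sum_step_diff (R : realType) (f : nat -> R) (q n L : nat) :
  \sum_(i < L) (f (n + q * i)%N - f (n + q * i + q)%N) = f n - f (n + q * L)%N.
Proof.
elim: L => [|L IHL]; first by rewrite big_ord0 muln0 addn0 subrr.
by rewrite big_ord_recr /= IHL mulnS (addnC q) addnA; ring.
Qed.

(** A discrete monotone density argument: the values of [g] along a progression
of step [q] add up to a difference of two values of [f], and monotonicity of [g]
compares each of them with a single one. For the upper bound, the sum of
[g (n + q * i)] over [i < n] is at most [f n]. For the lower bound, the sum from
[n] to [n * M] is at least half of [f n], as soon as [M] is so large that
[f (n * M)] is at most half of the lower bound for [f n]. *)
Lemma power_order_diff (R : realType) (f g : nat -> R) (b : R) (q : nat) :
  0 < b -> (0 < q)%N ->
  (forall n, (0 < n)%N -> 0 <= f n) ->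
  (forall n, (0 < n)%N -> 0 <= g n.+1 <= g n) ->
  (forall n, g n = f n - f (n + q)%N) ->
  power_order f b -> power_order g (b + 1).
Proof.
move=> b0 q0 f0 g01 gE [c [C [N [c0 fN]]]].
have gm := @nonincreasing_nat1 R g (fun n n0 => proj2 (andP (g01 n n0))).
have g0 n : (0 < n)%N -> 0 <= g n.
  by move=> /g01 /andP[g0 g1]; exact: le_trans g1.
have pM m n : (m * n)%N%:R `^ b = m%:R `^ b * n%:R `^ b :> R.
  by rewrite natrM powRM.
have pS n : (0 < n)%N -> n%:R `^ (b + 1) = n%:R `^ b * n%:R :> R.
  by move=> n0; rewrite powRD ?powRr1// pnatr_eq0 -lt0n n0 implybT.
have p0 n : (0 < n)%N -> 0 < n%:R `^ b :> R.
  by move=> n0; rewrite powR_gt0 ?ltr0n.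
have C0 : 0 < C by case/andP: (fN N (leqnn N)) => h1 h2; lra.
have upper m : ((q.+1 * N.+1) <= m)%N ->
    g m * m%:R `^ (b + 1) <= C * (2 * q.+1)%N%:R `^ b * (2 * q.+1)%N%:R.
  move=> hm; pose n := (m %/ q.+1)%N.
  have nN : (N.+1 <= n)%N by rewrite leq_divRL// mulnC.
  have n0 : (0 < n)%N by lia.
  have qnm : (q.+1 * n <= m)%N by rewrite mulnC leq_divM.
  have mqn : (m <= 2 * q.+1 * n)%N.
    by have := ltn_ceil m (ltn0Sn q); rewrite -/n; nia.
  have m0 : (0 < m)%N by lia.
  have ng : n%:R * g (q.+1 * n)%N <= f n.
    apply: (@le_trans _ _ (f n - f (n + q * n)%N)); last first.
      by rewrite gerBl f0//; lia.
    rewrite -sum_step_diff; under eq_bigr do rewrite -gE.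
    rewrite -[leLHS](_ : \sum_(i < n) g (q.+1 * n)%N = _); last first.
      by rewrite sumr_const card_ord mulr_natl.
    by apply: ler_sum => i _; apply: gm; [lia | have := ltn_ord i; nia].
  have gmq : g m <= g (q.+1 * n)%N by apply: gm => //; nia.
  have pmq : m%:R `^ b <= (2 * q.+1)%N%:R `^ b * n%:R `^ b :> R.
    by rewrite -pM ge0_ler_powR ?nnegrE ?ler0n ?ler_nat// ltW.
  have mR : m%:R <= (2 * q.+1)%N%:R * n%:R :> R by rewrite -natrM ler_nat.
  have fn : f n * n%:R `^ b <= C by case/andP: (fN n (ltnW nN)).
  rewrite pS// mulrA.
  apply: (@le_trans _ _ (g (q.+1 * n)%N * ((2 * q.+1)%N%:R `^ b * n%:R `^ b)
                         * ((2 * q.+1)%N%:R * n%:R))).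
    by rewrite !ler_pM ?mulr_ge0 ?g0 ?powR_ge0.
  set w := _%:R `^ b; set v := (2 * q.+1)%N%:R.
  rewrite [leLHS](_ : _ = n%:R * g (q.+1 * n)%N * n%:R `^ b * w * v); last ring.
  do 2!rewrite ler_wpM2r ?powR_ge0//.
  by apply: le_trans fn; rewrite ler_wpM2r ?powR_ge0.
(* The choice of [z] makes [c / 2 * z `^ b = C]; any integer [M >= z] will do,
   and [M = 1 mod q] lets the progression of step [q] from [n] end at [n * M]. *)
pose z : R := (2 * C / c) `^ b^-1.
pose L := (Num.bound z).
have z0 : 0 <= z by exact: powR_ge0.
have zL : z < L%:R by rewrite /L; apply: le_lt_trans (archi_boundP z0).
have L0 : (0 < L)%N by rewrite -(ltr0n R) (le_lt_trans z0 zL).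
pose M := (1 + q * L)%N.
have pMC : C <= c / 2 * M%:R `^ b.
  have -> : C = c / 2 * z `^ b.
    rewrite /z -powRrM mulVf ?gt_eqF// powRr1; last by rewrite !mulr_ge0 ?invr_ge0 ?ltW.
    by field; rewrite gt_eqF.
  rewrite ler_wpM2l ?divr_ge0 ?ltW//.
  rewrite gt0_ltr_powR ?nnegrE//.
  by apply: lt_le_trans zL _; rewrite ler_nat /M; nia.
exists (c / (2 * L%:R)), (C * (2 * q.+1)%N%:R `^ b * (2 * q.+1)%N%:R),
  (q.+1 * N.+1)%N; split.
  by rewrite divr_gt0 ?mulr_gt0 ?ltr0n.
move=> n hn; rewrite upper// andbT.
have nN : (N <= n)%N by nia.
have n0 : (0 < n)%N by nia.
have fnl : c <= f n * n%:R `^ b by case/andP: (fN n nN).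
have fnM : f (n * M)%N * n%:R `^ b <= c / 2.
  have /fN /andP[_] : (N <= n * M)%N by rewrite /M; nia.
  rewrite pM mulrA => h; have := le_trans h pMC.
  by rewrite ler_pM2r// p0.
have ng : f n - f (n * M)%N <= (n * L)%N%:R * g n.
  have -> : (n * M = n + q * (n * L))%N by rewrite /M; ring.
  rewrite -sum_step_diff; under eq_bigr do rewrite -gE.
  rewrite -[leRHS](_ : \sum_(i < n * L) g n = _); last first.
    by rewrite sumr_const card_ord mulr_natl.
  by apply: ler_sum => i _; apply: gm => //; lia.
have LR : 0 < L%:R :> R by rewrite ltr0n.
rewrite ler_pdivrMr ?mulr_gt0// pS//.
have := ler_wpM2r (ltW (p0 n n0)) ng; rewrite natrM mulrBl => h.
rewrite [leRHS](_ : _ = 2 * (n%:R * L%:R * g n * n%:R `^ b)); last ring.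
lra.
Qed.

Lemma power_order_cvg (R : realType) (x : nat -> R) (c alpha : R) :
  0 < c -> (fun n : nat => x n * n%:R `^ alpha) @ \oo --> c ->
  power_order x alpha.
Proof.
move=> c0 hlim.
have [N _ NP] : \forall n \near \oo,
    c / 2 <= x n * n%:R `^ alpha /\ x n * n%:R `^ alpha <= 2 * c.
  by apply: filterS2 (cvgr_ge c hlim (c / 2) _) (cvgr_le c hlim (2 * c) _) => //;
    lra.
exists (c / 2), (2 * c), N; split; first by rewrite divr_gt0.
by move=> n /NP [h1 h2]; rewrite h1.
Qed.

Lemma dyadic_diff_power_order (R : realType) (x : nat -> R) (alpha : R) :
  0 < alpha ->
  (forall k n, (0 < n)%N -> 0 <= dyadic_diff x k n.+1 <= dyadic_diff x k n) ->
  power_order x alpha ->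
  forall k, power_order (dyadic_diff x k) (alpha + k%:R).
Proof.
move=> a0 mono hx; elim=> [|k IHk]; first by rewrite addr0.
rewrite -natr1 addrA.
apply: (@power_order_diff R (dyadic_diff x k) (dyadic_diff x k.+1) _ (2 ^ k)).
- by rewrite ltr_wpDr.
- by rewrite expn_gt0.
- by move=> n /(mono k) /andP[]; exact: le_trans.
- by move=> n; exact: mono.
- by [].
- exact: IHk.
Qed.

(** The ratio [g n / f n] is of order [1 / n]. The factor [4] is small enough for
the comparisons between consecutive levels of the greedy process. *)
Lemma power_order_ratio (R : realType) (f g : nat -> R) (b : R) :
  power_order f b -> power_order g (b + 1) ->
  exists N : nat, forall n, (N <= n)%N -> 0 < f n /\ 4 * g n <= f n.
Proof.
move=> [c [C [N [c0 fN]]]] [c' [C' [N' [c'0 gN]]]].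
have C'0 : 0 < C'.
  by have /andP[h1 h2] := gN N' (leqnn N'); exact: lt_le_trans c'0 (le_trans h1 h2).
pose z := 4 * C' / c.
have z0 : 0 <= z by rewrite /z !mulr_ge0 ?invr_ge0 ?ltW.
exists (N + N' + (Num.bound z).+1)%N => n hn.
have n0 : (0 < n)%N by lia.
have nR : 0 < n%:R :> R by rewrite ltr0n.
have p0 : 0 < n%:R `^ b by rewrite powR_gt0.
have /andP[fl _] : c <= f n * n%:R `^ b <= C by apply: fN; lia.
have /andP[_ gu] : c' <= g n * n%:R `^ (b + 1) <= C' by apply: gN; lia.
split; first by rewrite -(pmulr_lgt0 _ p0); exact: lt_le_trans fl.
move: gu; rewrite powRD; last by rewrite pnatr_eq0 -lt0n n0 implybT.
rewrite powRr1 ?ler0n// mulrA => gu.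
have zn : z <= n%:R.
  apply: ltW; apply: lt_le_trans (archi_boundP z0) _; rewrite ler_nat; lia.
rewrite -(ler_pM2r p0); apply: le_trans fl.
rewrite -(ler_pM2r nR); apply: (@le_trans _ _ (4 * C')); first by lra.
by move: zn; rewrite /z ler_pdivrMr// (mulrC c).
Qed.

Lemma power_order_vanish (R : realType) (f : nat -> R) (a : R) (k : nat) :
  0 < a -> power_order f (a + k%:R) -> forall eps : R, 0 < eps ->
  exists N : nat, forall n, (N <= n)%N -> f n * n%:R ^+ k <= eps.
Proof.
move=> a0 [c [C [N [c0 fN]]]] eps eps0.
have C0 : 0 < C.
  by have /andP[h1 h2] := fN N (leqnn N); exact: lt_le_trans c0 (le_trans h1 h2).
pose z := (C / eps) `^ a^-1.
have z0 : 0 <= z by exact: powR_ge0.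
exists (N + (Num.bound z).+1)%N => n hn.
have n0 : (0 < n)%N by lia.
have pa : 0 < n%:R `^ a :> R by rewrite powR_gt0 ?ltr0n.
have zn : z <= n%:R.
  apply: ltW; apply: lt_le_trans (archi_boundP z0) _; rewrite ler_nat; lia.
have Cn : C / eps <= n%:R `^ a.
  have -> : C / eps = z `^ a.
    by rewrite /z -powRrM mulVf ?gt_eqF// powRr1// divr_ge0 ?ltW.
  by rewrite ge0_ler_powR ?nnegrE ?ler0n// ltW.
have /andP[_] : c <= f n * n%:R `^ (a + k%:R) <= C by apply: fN; lia.
rewrite powRD; last by rewrite pnatr_eq0 -lt0n n0 implybT.
rewrite powR_mulrn ?ler0n// => fu.
rewrite -(ler_pM2r pa); apply: (@le_trans _ _ C); first by lra.
by move: Cn; rewrite ler_pdivrMr// (mulrC eps).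
Qed.

(** * The greedy process at level [k] *)

(** The sign of the error is encoded by the boolean [0 < e n]; in particular a
zero error counts as negative, as in [greedy_sums]. *)
Definition greedy_error (R : realType) (x e : nat -> R) : Prop :=
  forall n, e n.+1 = e n + (-1) ^+ (0 < e n)%R * x n.+1.

(** The index [m] is that of the beginning of the last block: at level [k] the
error at [m + 2 ^ k] comes after a step of size [dyadic_diff x k m.+1]. *)
Definition trapped (R : realType) (x e : nat -> R) (k m : nat) : Prop :=
  `|e (m + 2 ^ k)%N| <= dyadic_diff x k m.+1.

Definition dyadic_decay (R : realType) (x : nat -> R) : Prop :=
  forall k, exists N, forall n, (N <= n)%N ->
    0 < dyadic_diff x k n /\ 4 * dyadic_diff x k.+1 n <= dyadic_diff x k n.

Lemma norm_step (R : realType) (u v : R) :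
  `|u + (-1) ^+ (0 < u)%R * v| = `| `|u| - v|.
Proof.
have [u0|u0] := ltP 0 u; first by rewrite expr1 mulN1r (gtr0_norm u0).
by rewrite expr0 mul1r (ler0_norm u0) -opprD normrN.
Qed.

Lemma step_sign (R : realType) (u v : R) : `|u| < v ->
  (0 < u + (-1) ^+ (0 < u)%R * v) = ~~ (0 < u).
Proof.
have [u0|u0] := ltP 0 u.
  rewrite expr1 mulN1r (gtr0_norm u0) => uv; apply/negbTE; by rewrite -leNgt subr_le0 ltW.
by rewrite expr0 mul1r (ler0_norm u0) -subr_gt0 opprK addrC.
Qed.

Lemma same_sign_norm (R : realType) (u v : R) :
  (0 < u + (-1) ^+ (0 < u)%R * v) = (0 < u) ->
  `|u + (-1) ^+ (0 < u)%R * v| = `|u| - v.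
Proof.
have [u0|u0] := ltP 0 u => h.
  by rewrite (gtr0_norm u0) gtr0_norm ?h// expr1 mulN1r.
move/negbT: h; rewrite -leNgt => h.
by rewrite (ler0_norm u0) ler0_norm// expr0; ring.
Qed.

(** Consecutive steps of level [k] differ by a step of level [k.+1]. *)
Lemma dyadic_diff_slow (R : realType) (x : nat -> R) (k m : nat) :
  4 * dyadic_diff x k.+1 m.+1 <= dyadic_diff x k m.+1 ->
  3 * dyadic_diff x k m.+1 <= 4 * dyadic_diff x k (m + 2 ^ k).+1.
Proof. by rewrite /= addSn; lra. Qed.

(** A block of length [2 ^ k.+1] consists of two blocks of length [2 ^ k]. The
error at its beginning is smaller than the steps of level [k], so the first half
overshoots [0], the second half moves back, and the two moves combine to a
difference of values of [dyadic_diff x k], that is, a value of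
[dyadic_diff x k.+1]. *)
Lemma block_step (R : realType) (x e : nat -> R) :
  dyadic_decay x -> greedy_error x e ->
  forall k, exists N, forall m, (N <= m)%N -> trapped x e k m ->
    e (m + 2 ^ k + 2 ^ k)%N = e (m + 2 ^ k)%N
      + (-1) ^+ (0 < e (m + 2 ^ k)%N)%R * dyadic_diff x k (m + 2 ^ k).+1.
Proof.
move=> decay he; elim=> [|k [N1 N1P]].
  by exists 0%N => m _ _; rewrite expn0 [in LHS]addn1 he.
have [N2 N2P] := decay k.
exists (N1 + N2)%N => m hm; rewrite /trapped.
have pE : (2 ^ k.+1 = 2 ^ k + 2 ^ k)%N by rewrite expnS mul2n addnn.
set d := dyadic_diff x k.
have dE n : dyadic_diff x k.+1 n = d n - d (n + 2 ^ k)%N by [].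
have [d0 dq0] := N2P m.+1 (ltac:(lia)).
have s0 := dyadic_diff_slow dq0.
have [d1 dq1] := N2P (m + 2 ^ k).+1 (ltac:(lia)).
have s1 := dyadic_diff_slow dq1.
rewrite -/d in d0 dq0 s0 d1 dq1 s1 => t.
have em : (m + 2 ^ k.+1 = m + 2 ^ k + 2 ^ k)%N by rewrite pE addnA.
rewrite em in t *.
set n := (m + 2 ^ k + 2 ^ k)%N in t s1 *.
have en : `|e n| < d n.+1 by lra.
have step1 : e (n + 2 ^ k)%N = e n + (-1) ^+ (0 < e n)%R * d n.+1.
  by apply: N1P; [lia | rewrite /trapped -/d -/n; lra].
have sgn1 : (0 < e (n + 2 ^ k)%N) = ~~ (0 < e n) by rewrite step1 step_sign.
have nrm1 : `|e (n + 2 ^ k)%N| <= d n.+1.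
  rewrite step1 norm_step ler_norml.
  by have := normr_ge0 (e n); move: en => + +; lra.
have step2 := N1P n (ltac:(lia)) nrm1.
rewrite pE addnA step2 sgn1 step1 dE addSn -/d.
by rewrite -addrA; congr (_ + _); case: (0 < e n) => /=; ring.
Qed.

(** Since the steps of level [k] shrink slowly, an error below the previous step is
below twice the next one, so it stays trapped. If moreover the sign does not
change, the new absolute error is the old one minus the step, hence at most the
difference of two consecutive steps, which is a step of level [k.+1]. *)
Lemma trapped_next (R : realType) (x e : nat -> R) (k m : nat) :
  4 * dyadic_diff x k.+1 m.+1 <= dyadic_diff x k m.+1 ->
  trapped x e k m ->
  e (m + 2 ^ k + 2 ^ k)%N = e (m + 2 ^ k)%N
    + (-1) ^+ (0 < e (m + 2 ^ k)%N)%R * dyadic_diff x k (m + 2 ^ k).+1 ->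
  trapped x e k (m + 2 ^ k) /\
  ((0 < e (m + 2 ^ k + 2 ^ k)%N) = (0 < e (m + 2 ^ k)%N) -> trapped x e k.+1 m).
Proof.
move=> dq t es; have s0 := dyadic_diff_slow dq; split.
  rewrite /trapped es norm_step ler_norml.
  by have := normr_ge0 (e (m + 2 ^ k)%N); move: t; rewrite /trapped; lra.
rewrite /trapped expnS mul2n -addnn addnA es => /same_sign_norm ->.
by rewrite /= addSn; move: t; rewrite /trapped; lra.
Qed.

(** If the next level is never reached, the errors along the progression alternate
in sign, so that their increments are the terms of an alternating series; and they
tend to [0] because they stay trapped. *)
Lemma trapped_ascend (R : realType) (x e : nat -> R) (k : nat) :
  dyadic_decay x -> greedy_error x e ->
  (forall eps : R, 0 < eps -> exists N, forall n, (N <= n)%N ->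
     dyadic_diff x k n <= eps) ->
  exists N, forall m, (N <= m)%N -> trapped x e k m ->
  (exists2 m', (m <= m')%N & trapped x e k.+1 m') \/
  - e (m + 2 ^ k)%N = (-1) ^+ (0 < e (m + 2 ^ k)%N)%R *
     limn (fun j => \sum_(i < j) (-1) ^+ i *
        dyadic_diff x k (m + 2 ^ k + 2 ^ k * i).+1).
Proof.
move=> decay he vanish.
have [N1 N1P] := block_step decay he k.
have [N2 N2P] := decay k.
exists (N1 + N2)%N => m hm t0.
pose p j := (m + 2 ^ k * j)%N.
have p0 : p 0%N = m by rewrite /p muln0 addn0.
have pS j : p j.+1 = (p j + 2 ^ k)%N by rewrite /p mulnS; lia.
have quarter j : 4 * dyadic_diff x k.+1 (p j).+1 <= dyadic_diff x k (p j).+1.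
  by apply: (N2P _ _).2; rewrite /p; lia.
have tp j : trapped x e k (p j).
  elim: j => [|j IHj]; first by rewrite p0.
  rewrite pS; apply: (trapped_next (quarter j) IHj _).1.
  by apply: N1P => //; rewrite /p; lia.
have st j : e (p j.+2) = e (p j.+1) +
    (-1) ^+ (0 < e (p j.+1))%R * dyadic_diff x k (p j.+1).+1.
  by rewrite !pS; apply: N1P => //; rewrite /p; lia.
have [[j same]|alt] := pselect (exists j, (0 < e (p j.+2)) = (0 < e (p j.+1))).
  left; exists (p j); first by rewrite /p; lia.
  apply: (trapped_next (quarter j) (tp j) _).2; last by rewrite -!pS.
  by rewrite -!pS.
right.
have p1 i : (m + 2 ^ k + 2 ^ k * i)%N = p i.+1 by rewrite /p mulnS addnA.
have p10 : (m + 2 ^ k)%N = p 1%N by rewrite pS p0.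
under eq_fun do under eq_bigr do rewrite p1.
rewrite p10; set b := 0 < e (p 1%N).
have sg j : (0 < e (p j.+1)) = b (+) odd j.
  elim: j => [|j IHj]; first by rewrite addbF.
  rewrite oddS addbN -IHj.
  have : (0 < e (p j.+2)) <> (0 < e (p j.+1)) by move=> h; apply: alt; exists j.
  by case: (0 < e (p j.+2)); case: (0 < e (p j.+1)).
have sumE j : \sum_(i < j) (-1) ^+ i * dyadic_diff x k (p i.+1).+1 =
    (-1) ^+ b * (e (p j.+1) - e (p 1%N)).
  elim: j => [|j IHj]; first by rewrite big_ord0 subrr mulr0.
  rewrite big_ord_recr /= IHj st sg signr_addb signr_odd.
  by case: (b) => /=; rewrite ?expr1 ?expr0; ring.
have e0 : (fun j => e (p j.+1)) @ \oo --> (0 : R).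
  apply/cvgrPdist_le => eps eps0.
  have [N3 N3P] := vanish _ eps0.
  exists N3 => // j /= hj; rewrite sub0r normrN pS.
  apply: le_trans (tp j) _; apply: N3P; rewrite /p.
  by have := expn_gt0 2 k; nia.
have -> : limn (fun j => \sum_(i < j) (-1) ^+ i *
        dyadic_diff x k (p i.+1).+1) = (-1) ^+ b * (0 - e (p 1%N)).
  apply: cvg_lim => //; under eq_fun do rewrite sumE.
  by apply: cvgMr; apply: cvgB e0 _; exact: cvg_cst.
by rewrite sub0r mulrA -expr2 sqrr_sign mul1r.
Qed.

(** Between two crossings the absolute error decreases by [x (j + i)] at step
[j + i]; starting from at most [x j], it would be exhausted after [l] steps. *)
Lemma trapped_recurrent (R : realType) (x e : nat -> R) (l m m' : nat) :
  greedy_error x e -> (forall n, (0 < n)%N -> 0 <= x n) ->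
  (forall j : nat, (1 <= j)%N -> (m <= j)%N ->
     x j <= \sum_(1 <= i < l.+1) x (j + i)%N) ->
  (0 < l)%N -> (m <= m')%N -> trapped x e 0 m' ->
  exists2 m'', (m' < m'')%N & trapped x e 0 m''.
Proof.
move=> he x0 hl l0 mm'; rewrite /trapped /= addn1 => t.
apply: contrapT => no.
have big i : `|e (m'.+1 + i.+1)%N| > x (m'.+1 + i.+1)%N.
  rewrite ltNge; apply/negP => h; apply: no; exists (m'.+1 + i)%N; first by lia.
  by rewrite /trapped /= addn1 -addnS.
have nrm i : `|e (m'.+1 + i)%N| =
    `|e m'.+1| - \sum_(1 <= a < i.+1) x (m'.+1 + a)%N.
  elim: i => [|i IHi]; first by rewrite addn0 big_geq// subr0.
  rewrite big_nat_recr//= opprD addrA -IHi.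
  have := big i; rewrite addnS he norm_step.
  set u := `|e _|; set v := x _ => h.
  have [uv|uv] := leP v u; first by rewrite ger0_norm// subr_ge0.
  move: h; rewrite ltr0_norm ?subr_lt0//.
  have : 0 <= u := normr_ge0 _; lra.
have := big l.-1; rewrite (prednK l0) => h.
have := nrm l; move: t; have := hl m'.+1 isT (ltac:(lia)); have := normr_ge0 (e (m'.+1 + l)%N).
have := x0 (m'.+1 + l)%N isT; lra.
Qed.

(** * The exceptional set and the theorem *)

(** The point determined by the signs [s] of the first [n] steps when, from the
index [n] on, the process stays at level [k] with alternating signs, starting with
the sign given by [b]. The parameters range over a countable type, so these points
form a countable set. *)
Definition exceptional_value (R : realType) (x : nat -> R)
    (p : (nat * nat) * (bool * seq bool)) : R :=
  let: ((k, n), (b, s)) := p in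
  \sum_(i < n) (-1) ^+ (nth false s i) * x i.+1 +
  (-1) ^+ b * limn (fun j => \sum_(i < j) (-1) ^+ i *
                               dyadic_diff x k (n + 2 ^ k * i).+1).

Lemma greedy_sums_step (R : realType) (x : nat -> R) (y : R) (n : nat) :
  greedy_sums x y n.+1 =
  greedy_sums x y n + (-1) ^+ (y < greedy_sums x y n)%R * x n.+1.
Proof.
rewrite /=; have [h|h] := leP (greedy_sums x y n) y.
  by rewrite expr0 mul1r.
by rewrite expr1 mulN1r.
Qed.

Lemma greedy_sums_signed (R : realType) (x : nat -> R) (y : R) (n : nat) :
  exists s : seq bool,
    greedy_sums x y n = \sum_(i < n) (-1) ^+ (nth false s i) * x i.+1.
Proof.
pose s := mkseq (fun i => y < greedy_sums x y i) n.
exists s.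
have h m : (m <= n)%N ->
    greedy_sums x y m = \sum_(i < m) (-1) ^+ (nth false s i) * x i.+1.
  elim: m => [|m IHm] mn; first by rewrite big_ord0.
  by rewrite greedy_sums_step big_ord_recr [nth false s _]nth_mkseq// -IHm// ltnW.
exact: h (leqnn n).
Qed.

Lemma dist_between (R : realType) (a b y : R) :
  Num.min a b <= y -> y <= Num.max a b -> `|b - y| <= `|b - a|.
Proof.
have [ab|ba] := leP a b => h1 h2.
  by rewrite !ger0_norm ?subr_ge0// lerD2l lerN2.
by rewrite !ler0_norm ?subr_le0 ?(ltW ba)// lerN2 lerD2l lerN2.
Qed.

Theorem theorem2 (R : realType) (x : nat -> R) (c alpha : R)
    (hx : moment_sequence x) (hc : 0 < c) (halpha : 0 < alpha)
    (hlim : (fun n : nat => x n * n%:R `^ alpha) @ \oo --> c) :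
  exists X : set R, countable X /\
    forall y : R, ~ X y ->
      (exists m : nat,
        (Num.min (greedy_sums x y m) (greedy_sums x y m.+1) <= y /\
         y <= Num.max (greedy_sums x y m) (greedy_sums x y m.+1)) /\
        exists l : nat, (1 <= l)%N /\
          forall j : nat, (1 <= j)%N -> (m <= j)%N ->
            x j <= \sum_(1 <= i < l.+1) x (j + i)%N) ->
      forall k : nat,
        infinite_set [set n : nat | (1 <= n)%N /\
                        `|y - greedy_sums x y n| <= 1 / n%:R ^+ k].
Proof.
have mono := moment_dyadic_diff_monotone hx.
have ord := dyadic_diff_power_order halpha mono (power_order_cvg hc hlim).
have decay : dyadic_decay x.
  move=> k; apply: (power_order_ratio (ord k)).
  by have := ord k.+1; rewrite -natr1 addrA.
have d0 k n : (0 < n)%N -> 0 <= dyadic_diff x k n.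
  by move=> /(mono k) /andP[]; exact: le_trans.
have small k := power_order_vanish halpha (ord k).
have vanish k (eps : R) : 0 < eps -> exists N, forall n, (N <= n)%N ->
    dyadic_diff x k n <= eps.
  move=> /(small k) [N NP]; exists N.+1 => n hn.
  apply: le_trans (NP n (ltnW hn)); rewrite ler_peMr ?d0//; first lia.
  by rewrite exprn_ege1// ler1n; lia.
exists (range (exceptional_value x)); split.
  apply: sub_countable (card_image_le _ _) _; exact: countableP.
move=> y yX [m [[ymin ymax] [l [l0 hl]]]] k.
pose e n := greedy_sums x y n - y.
have he : greedy_error x e.
  by move=> n; rewrite /e greedy_sums_step subr_gt0 addrAC.
have x0 n : (0 < n)%N -> 0 <= x n by exact: (d0 0%N).
have t0 : trapped x e 0 m.
  rewrite /trapped /= addn1.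
  apply: le_trans (dist_between ymin ymax) _.
  by rewrite greedy_sums_step addrC addKr normrM normr_sign mul1r ger0_norm ?x0.
have ex0 n0 : exists2 m', (n0 <= m')%N & (m <= m')%N /\ trapped x e 0 m'.
  elim: n0 => [|n0 [m1 h1 [h2 h3]]]; first by exists m.
  have [m2 h4 h5] := trapped_recurrent he x0 hl l0 h2 h3.
  by exists m2; [lia | split => //; lia].
have exk j n0 : exists2 m', (n0 <= m')%N & trapped x e j m'.
  elim: j n0 => [|j IHj] n0; first by have [m' h1 [_ h2]] := ex0 n0; exists m'.
  have [N NP] := trapped_ascend decay he (vanish j).
  have [m1 h1 h2] := IHj (n0 + N)%N.
  have [|[m2 h3 h4]|res] := NP m1 _ h2; [lia | by exists m2 => //; lia |].
  have [s hs] := greedy_sums_signed x y (m1 + 2 ^ j)%N.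
  case: yX; exists (j, (m1 + 2 ^ j)%N, (0 < e (m1 + 2 ^ j)%N, s)) => //=.
  by rewrite -hs -res /e; ring.
move=> /finite_seqP[s sE].
have [N1 N1P] := decay k.
have [N2 N2P] := small k (1 / 2) (ltac:(lra)).
have [m' hm' tm'] := exk k (N1 + N2 + \max_(i <- s) i)%N.
pose n := (m' + 2 ^ k)%N.
have k0 : (0 < 2 ^ k)%N by rewrite expn_gt0.
have n0 : (0 < n)%N by rewrite /n; lia.
suff : [set` s] n.
  move=> /= ns; have := @leq_bigmax_seq nat s xpredT (fun i => i) n ns isT.
  by rewrite /= /n in hm' *; lia.
rewrite -sE /=; split => //.
have [_ /dyadic_diff_slow dn] := N1P m'.+1 (ltac:(lia)).
have /andP[_ dn1] := mono k _ n0.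
have dn2 := N2P n (ltac:(rewrite /n; lia)).
have en : `|y - greedy_sums x y n| <= 2 * dyadic_diff x k n.
  rewrite distrC; move: tm'; rewrite /trapped -/n /e.
  have := d0 k n n0; rewrite -/n in dn; lra.
by rewrite ler_pdivlMr ?exprn_gt0 ?ltr0n//; apply: le_trans (ler_wpM2r _ en) _;
  [rewrite exprn_ge0 | lra].
Qed.
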